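(* Let $A$ and $C$ be locally finite (nonnegative) Borel measures on $[0,\infty)$ without atoms. Consider the integral equation $$Q(t) = \int_0^t \mathbf 1\big(Q(s) > C(s,t]\big)\, dA(s), \qquad t \ge 0,$$ for an unknown nonnegative measurable function $Q:[0,\infty)\to[0,\infty)$. This equation admits a unique maximal solution, i.e. a solution which pointwise dominates any other solution. Moreover, this maximal solution is precisely the function $$Q^*(t) := \sup_{0\le s\le t} \big(A(s,t] - C(s,t]\big), \qquad t\ge 0.$$
   Context: Locally finite means finite on bounded Borel sets. For a measure $\mu$ write $\mu(s,t] := \mu((s,t])$. ''Without atoms'' means $\mu(\{t\})=0$ for every $t$. $\mathbf 1(\cdot)$ denotes the indicator of the condition in parentheses. A solution $Q$ is maximal if $\widetilde Q(t)\le Q(t)$ for all $t\ge 0$ and every solution $\widetilde Q$. *)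

(* Defs.v *)
From mathcomp Require Export all_boot all_order all_algebra.
From mathcomp Require Export all_classical all_reals all_analysis.
Export Order.TTheory GRing.Theory Num.Theory numFieldNormedType.Exports.

Set Implicit Arguments.
Unset Strict Implicit.
Unset Printing Implicit Defensive.

Local Open Scope classical_set_scope.
Local Open Scope ring_scope.
Local Open Scope ereal_scope.

(* Borel measures on [0, +oo[ are encoded as Borel measures on the real line
   that give no mass to the negative half-line. *)
Definition on_nonneg (R : realType)
    (mu : {measure set (measurableTypeR R) -> \bar R}) : Prop :=
  mu `]-oo, 0%R[%classic = 0.

Definition locally_finite (R : realType)
    (mu : {measure set (measurableTypeR R) -> \bar R}) : Prop :=
  forall B : set R, @measurable _ (measurableTypeR R) B -> bounded_set B ->
    mu B < +oo.

Definition atomless (R : realType)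
    (mu : {measure set (measurableTypeR R) -> \bar R}) : Prop :=
  forall t : R, mu [set t] = 0.

(* Functions on [0, +oo[ are encoded as functions on the real line whose values
   at negative arguments are irrelevant. *)
Definition is_solution (R : realType)
    (A C : {measure set (measurableTypeR R) -> \bar R}) (Q : R -> R) : Prop :=
  [/\ measurable_fun (`[0%R, +oo[%classic : set (measurableTypeR R))
        (Q : measurableTypeR R -> measurableTypeR R),
      forall t : R, (0 <= t)%R -> (0 <= Q t)%R &
      forall t : R, (0 <= t)%R ->
        (Q t)%:E =
        \int[A]_(s in `[0%R, t])
          (\1_[set r : R | ((Q r)%:E > C `]r, t]%classic)%E] s)%:E].

Definition is_maximal_solution (R : realType)
    (A C : {measure set (measurableTypeR R) -> \bar R}) (Q : R -> R) : Prop :=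
  is_solution A C Q /\
  forall Q' : R -> R, is_solution A C Q' ->
    forall t : R, (0 <= t)%R -> (Q' t <= Q t)%R.

Definition Qstar (R : realType)
    (A C : {measure set (measurableTypeR R) -> \bar R}) (t : R) : \bar R :=
  ereal_sup [set A `]s, t]%classic - C `]s, t]%classic | s in `[0%R, t]].

(* Main.v *)
(* Put a(t) = A[0,t] and c(t) = C[0,t]. These functions are continuous and
   nondecreasing, and Q solves the equation iff Q(t) is the A-mass of
   {s <= t : Q(s) + c(s) > c(t)}. Let I(t) be the maximum of c - a on [0,t].
   Then Qstar = a - c + I, and Qstar + c = a + I is nondecreasing. If m is a
   maximizer of c - a on [0,t], the set above is {s <= t : a(s) > c(t) - I(t)}
   for Q = Qstar, and by the intermediate value theorem its A-mass is
   a(t) - c(t) + I(t).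
   For maximality, suppose a solution Q has Q + c - a > K > I(t) somewhere on
   [0,t], and let tau be the infimum of such times. Before tau, Q + c <= a + K.
   Since c(tau) - K < a(tau), for such a time s close to tau every r in [tau,s]
   has a(r) > c(s) - K. Hence {r <= s : Q(r) + c(r) > c(s)} is contained in
   {r <= s : a(r) > c(s) - K}, whose A-mass is at most a(s) - c(s) + K. So
   Q(s) + c(s) - a(s) <= K, a contradiction. *)
Require Import Defs.
From mathcomp Require Import measurable_realfun lra.
Local Open Scope classical_set_scope.
Local Open Scope ring_scope.

(** Real-valued, so that continuity and order arguments take place in [R]; at negative [t] the
    interval is empty and the value is 0. *)
Definition mass {R : realType}
    (mu : {measure set (measurableTypeR R) -> \bar R}) (t : R) : R :=
  fine (mu `[0, t]%classic).

Lemma measurable_superlevel {R : realType} {f : R -> R} (t v : R) :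
  measurable_fun (`[0, +oo[%classic : set (measurableTypeR R))
    (f : measurableTypeR R -> measurableTypeR R) ->
  measurable (`[0, t]%classic `&` [set s | v < f s] : set (measurableTypeR R)).
Proof.
move=> mf; rewrite (_ : [set s | _] = f @^-1` `]v, +oo[%classic); last first.
  by apply/seteqP; split=> s /=; rewrite in_itv /= andbT.
apply: measurable_funS mf _ _ _ => // x /=.
by rewrite !in_itv /= => /andP[-> _].
Qed.

(** * Distribution functions of locally finite atomless measures *)

Section Mass.
Context {R : realType} {mu : {measure set (measurableTypeR R) -> \bar R}}.
Context (mu_fin : locally_finite mu) (mu_atomless : atomless mu).

Lemma itv_mass_lty (a b : R) : (mu `[a, b]%classic < +oo)%E.
Proof. by apply: mu_fin => //; exact/compact_bounded/segment_compact. Qed.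

Lemma massE (t : R) : mu `[0, t]%classic = (mass mu t)%:E.
Proof. by rewrite /mass fineK // ge0_fin_numE // itv_mass_lty. Qed.

Lemma mass_itv (s t : R) : 0 <= s -> s <= t ->
  mu `]s, t]%classic = (mass mu t - mass mu s)%:E.
Proof.
move=> s0 st.
have -> : mass mu t = fine (mu `[0%R, s]%classic + mu `]s, t]%classic)%E.
  rewrite -measureU //; last first.
    by rewrite -subset0 => x /= []; rewrite !in_itv /= => /andP[_ ?] /andP[]; lra.
  congr (fine (mu _)); apply/seteqP; split=> x /=; rewrite !in_itv /=.
    by move=> /andP[x0 xt]; case: (leP x s) => xs; [left|right]; apply/andP; split; lra.
  by move=> [] /andP[? ?]; apply/andP; split; lra.
have fin : mu `]s, t]%classic \is a fin_num.
  rewrite ge0_fin_numE //; apply: le_lt_trans (itv_mass_lty s t).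
  by rewrite le_measure ?inE //; exact: subset_itv_oc_cc.
by rewrite massE fineD //= addrAC subrr add0r fineK.
Qed.

Lemma mass_nondecreasing : {homo mass mu : s t / s <= t}.
Proof.
move=> s t st; rewrite -lee_fin -!massE le_measure ?inE //.
by move=> x /=; rewrite !in_itv /= => /andP[-> xs] /=; lra.
Qed.

Lemma mass_le0 (t : R) : t <= 0 -> mass mu t = 0.
Proof.
move=> t0; apply: EFin_inj; rewrite -massE; apply/eqP.
rewrite eq_le measure_ge0 andbT -[leRHS](mu_atomless 0) le_measure ?inE //.
by move=> x /=; rewrite in_itv /= => /andP[? ?]; lra.
Qed.

Lemma mass_ge0 (t : R) : 0 <= mass mu t.
Proof. by rewrite -lee_fin -massE. Qed.

Lemma massB_le (a b s t : R) : a <= s -> t <= b ->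
  mass mu t - mass mu s <= fine (mu `[a, b]%classic).
Proof.
move=> sa tb; rewrite lerBlDl -lee_fin EFinD -!massE fineK; last first.
  by rewrite ge0_fin_numE // itv_mass_lty.
apply: le_trans (measureU2 _ _ _) => //; apply: le_measure; rewrite ?inE //.
  exact: measurableU.
move=> x /=; rewrite !in_itv /= => /andP[x0 xt].
by case: (leP x s) => xs; [left|right]; apply/andP; split; lra.
Qed.

Lemma mass_dist_le (x y d : R) : `|x - y| < d ->
  `|mass mu x - mass mu y| <= fine (mu `[x - d, x + d]%classic).
Proof.
rewrite ltr_norml => /andP[xy yx]; rewrite ler_norml lerNl opprB.
by rewrite !massB_le //; lra.
Qed.

(** The intervals [F n] shrink to [[set x]], which is null, so their measures tend to 0; these bound
    the increments of [mass mu] near [x]. *)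
Lemma mass_continuous : continuous (mass mu).
Proof.
move=> x; apply/cvgrPdist_lt => e e0.
pose F (n : nat) : set (measurableTypeR R) := `[x - n.+1%:R^-1, x + n.+1%:R^-1]%classic.
have FI : \bigcap_n F n = [set x].
  apply/seteqP; split=> [y Fy|_ -> n _]; last first.
    by rewrite /F /= in_itv /= lerBlDr lerDl invr_ge0 ler0n.
  apply/eqP/negPn/negP => yx; have yx0 : 0 < `|y - x| by rewrite normr_gt0 subr_eq0.
  have [n _ /(_ n (leqnn n)) /=] := near_infty_natSinv_lt (PosNum yx0).
  have := Fy n I; rewrite /F /= in_itv /= => /andP[? ?].
  by apply/negP; rewrite -leNgt ler_norml lerNl opprB lerBlDl -lerBlDr [X in _ && X]lerBlDl; apply/andP.
have : mu \o F @ \oo --> mu (\bigcap_n F n).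
  apply: nonincreasing_cvg_mu => //.
  - exact: itv_mass_lty.
  - by move=> n; exact: measurable_itv.
  - by rewrite FI; exact: measurable_set1.
  - move=> n m nm; apply/subsetPset => y /=; rewrite /F /= !in_itv /= => /andP[xy yx].
    have : m.+1%:R^-1 <= n.+1%:R^-1 :> R by rewrite lef_pV2 ?posrE // ler_nat.
    move=> mn; apply/andP; split.
      by apply: le_trans xy; rewrite lerD2l lerN2.
    by apply: le_trans yx _; rewrite lerD2l.
rewrite FI mu_atomless => /fine_cvgP[_] /cvgrPdist_lt /(_ _ e0)[n _ /(_ n (leqnn n)) /=].
rewrite sub0r normrN => Fn.
have n0 : 0 < n.+1%:R^-1 :> R by rewrite invr_gt0 ltr0n.
apply/nbhs_ballP; exists n.+1%:R^-1 => //= y; rewrite /ball /= => xy.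
by apply: le_lt_trans (mass_dist_le _ _ _ xy) _; rewrite ger0_norm ?fine_ge0 in Fn.
Qed.

Lemma measurable_mass (D : set (measurableTypeR R)) : measurable D ->
  measurable_fun D (mass mu : measurableTypeR R -> measurableTypeR R).
Proof.
by move=> mD; apply: nondecreasing_measurable => //; exact: mass_nondecreasing.
Qed.

Lemma mass_superlevel (t v : R) : 0 <= t -> 0 <= v -> v <= mass mu t ->
  mu (`[0, t]%classic `&` [set s | v < mass mu s]) = (mass mu t - v)%:E.
Proof.
move=> t0 v0 vt.
have ivt w : 0 <= w -> w <= mass mu t -> exists2 r, 0 <= r <= t & mass mu r = w.
  move=> w0 wt; have [||r] := @IVT R (mass mu) 0 t w t0.
  - exact/continuous_subspaceT/mass_continuous.
  - by rewrite (mass_le0 0 (lexx 0)) min_l ?mass_ge0 // max_r ?mass_ge0 // w0.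
  - by rewrite in_itv /=; exists r.
have mS : measurable (`[0, t]%classic `&` [set s | v < mass mu s]).
  by apply: measurable_superlevel; exact: measurable_mass.
apply/eqP; rewrite eq_le; apply/andP; split.
  have [r /andP[r0 rt] rv] := ivt v v0 vt.
  rewrite -[in leRHS]rv -mass_itv // le_measure ?inE // => s /= [].
  rewrite !in_itv /= => /andP[s0 ->] vs; rewrite andbT ltNge.
  by apply/negP => /mass_nondecreasing; lra.
(* [mass mu] may stay at [v] just after a point where it takes this value, so the lower bound starts
   from a point at level [v + e], beyond which the strict inequality holds. *)
apply/lee_addgt0Pr => e e0; rewrite -leeBlDr //.
have [te|te] := leP (mass mu t) (v + e).
  by apply: (@le_trans _ _ 0%E) => //; rewrite -EFinB lee_fin; lra.
have [|r /andP[r0 rt] rv] := ivt (v + e) _ (ltW te); first by lra.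
rewrite -EFinB -addrA -opprD -rv -mass_itv // le_measure ?inE //.
move=> s /=; rewrite !in_itv /= => /andP[rs st]; split; first by apply/andP; split; lra.
by have := mass_nondecreasing _ _ (ltW rs); lra.
Qed.

End Mass.

(** * The supremum and the equation in terms of [a] and [c] *)

Section Queue.
Context {R : realType} {A C : {measure set (measurableTypeR R) -> \bar R}}.
Context (A_fin : locally_finite A) (C_fin : locally_finite C).
Context (A_atomless : atomless A) (C_atomless : atomless C).
Let a := mass A.
Let c := mass C.

(** Only the term [c s - a s] of [A ]s, t] - C ]s, t]] varies with [s]; being continuous, it has a
    maximum on the compact interval. *)
Lemma Qstar_attained (t : R) : 0 <= t -> exists m,
  [/\ 0 <= m <= t, forall s, 0 <= s <= t -> c s - a s <= c m - a m &
      Qstar A C t = (a t - c t + (c m - a m))%:E].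
Proof.
move=> t0; have [|m mt mmax] := @EVT_max R (fun s => c s - a s) 0 t t0.
  apply: continuous_subspaceT => x.
  by apply: cvgB; apply: mass_continuous.
rewrite in_itv /= in mt; exists m.
have {}mmax s : 0 <= s <= t -> c s - a s <= c m - a m by exact: mmax.
split=> //.
have AC s : 0 <= s <= t ->
    (A `]s, t]%classic - C `]s, t]%classic)%E = (a t - c t + (c s - a s))%:E.
  move=> /andP[s0 st]; rewrite !mass_itv // -EFinB; congr (_%:E); rewrite /a /c; lra.
apply/eqP; rewrite eq_le; apply/andP; split.
  apply: ge_ereal_sup => _ /= [s st <-]; rewrite in_itv /= in st.
  by rewrite AC // lee_fin lerD2l mmax.
by apply: ereal_sup_ubound; exists m; rewrite ?AC //= in_itv.
Qed.

(** Since [C ]s, t]] is [c t - c s], moving [c s] across separates [s] from [t] in the indicator's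
    condition. *)
Lemma indic_integralE (Q : R -> R) (t : R) :
  measurable_fun (`[0, +oo[%classic : set (measurableTypeR R))
    (Q : measurableTypeR R -> measurableTypeR R) ->
  (\int[A]_(s in `[0%R, t])
     (\1_[set r : R | ((Q r)%:E > C `]r, t]%classic)%E] s)%:E)%E =
  A (`[0, t]%classic `&` [set s | c t < Q s + c s]).
Proof.
move=> mQ; set S := _ `&` _.
have mS : measurable (S : set (measurableTypeR R)).
  apply: measurable_superlevel; apply: measurable_funD => //.
  exact: measurable_mass.
transitivity (\int[A]_(s in `[0%R, t]) (\1_S s)%:E)%E; last first.
  by rewrite integral_indic // setIidl // => s [].
apply: eq_integral => s; rewrite inE /= => st; congr (_%:E).
rewrite !indicE; congr (nat_of_bool _)%:R; apply: asbool_equiv_eq => /=.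
have /andP[s0 sl] : 0 <= s <= t by rewrite in_itv /= in st.
by rewrite mass_itv // lte_fin ltrBlDr; split=> [|[]].
Qed.

(** * The supremum formula gives a solution *)

Let Q (t : R) : R := fine (Qstar A C t).

Lemma fine_QstarE (t : R) : 0 <= t -> (Q t)%:E = Qstar A C t.
Proof. by move=> /Qstar_attained[m [_ _ QE]]; rewrite /Q QE. Qed.

Lemma Qstar_ge0 (t : R) : 0 <= t -> 0 <= Q t.
Proof.
move=> t0; have [m [_ mmax QE]] := Qstar_attained t t0.
have := mmax t; rewrite t0 lexx => /(_ isT); rewrite /Q QE /=; lra.
Qed.

(** The supremum over the empty set is [-oo], which [fine] sends to 0. This extends the monotonicity
    of [Q + c] to the whole line, as the measurability argument requires. *)
Lemma QstarDc_lt0 (t : R) : t < 0 -> Q t + c t = 0.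
Proof.
move=> t0; rewrite /c (mass_le0 C_fin C_atomless t (ltW t0)) addr0.
rewrite /Q /Qstar (_ : [set _ | _ in _] = set0) ?ereal_sup0 //.
rewrite -subset0 => y /= [r]; rewrite in_itv /= => /andP[r0 rt] _.
by have := le_trans r0 rt; rewrite leNgt t0.
Qed.

Lemma QstarDc_nondecreasing : {homo (fun t => Q t + c t) : s t / s <= t}.
Proof.
move=> s t st /=; have [s0|s0] := leP 0 s.
  have [m [/andP[m0 ms] mmax QsE]] := Qstar_attained s s0.
  have [n [_ nmax QtE]] := Qstar_attained t (le_trans s0 st).
  have := nmax m; rewrite m0 (le_trans ms st) => /(_ isT).
  by have := mass_nondecreasing A_fin _ _ st; rewrite /Q QsE QtE /= /a; lra.
rewrite (QstarDc_lt0 s s0); have [t0|t0] := leP 0 t; last by rewrite QstarDc_lt0.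
by rewrite addr_ge0 ?Qstar_ge0 ?mass_ge0.
Qed.

Lemma Qstar_solution : is_solution A C Q.
Proof.
have mQ : measurable_fun (`[0, +oo[%classic : set (measurableTypeR R))
    (Q : measurableTypeR R -> measurableTypeR R).
  rewrite (_ : Q = fun t => (Q t + c t) - c t); last first.
    by apply/funext => t; rewrite addrK.
  apply: measurable_funB; apply: nondecreasing_measurable => //.
    exact: QstarDc_nondecreasing.
  exact: mass_nondecreasing.
split=> // [|t t0]; first exact: Qstar_ge0.
rewrite indic_integralE //.
have [m [/andP[m0 mt] mmax QE]] := Qstar_attained t t0.
have ct : c m <= c t by exact: mass_nondecreasing.
have at_ : a m <= a t by exact: mass_nondecreasing.
have := mmax t; rewrite t0 lexx => /(_ isT) tm.
have am0 : 0 <= a m by exact: mass_ge0.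
(* The level lies in [[0, a t]]: it is nonnegative because [m <= t], and at most [a t] because [m]
   is a maximizer. *)
rewrite (_ : _ `&` _ = `[0, t]%classic `&` [set s | c t - c m + a m < a s]).
  rewrite mass_superlevel //; [|lra|rewrite -/a; lra].
  rewrite /Q QE /= -/a; congr (_%:E); lra.
(* Before [m] both sides fail; after [m] the running maximum of [c - a] stays
   at its value in [m]. *)
have SE s : 0 <= s <= t ->
    (c t < Q s + c s) = (c t - c m + a m < a s).
  move=> /andP[s0 st]; have [sm|ms] := leP s m.
    have Qsm := QstarDc_nondecreasing s m sm; rewrite /= in Qsm.
    have asm : a s <= a m by exact: mass_nondecreasing.
    (* [m] also maximizes [c - a] on [[0, m]], so [Q m] is at most 0. *)
    have Qcm : Q m + c m <= c m.
      have [n [/andP[n0 nm] _ QmE]] := Qstar_attained m m0.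
      have := mmax n; rewrite n0 (le_trans nm mt) => /(_ isT).
      by rewrite /Q QmE /=; lra.
    by apply/idP/idP; lra.
  have [n [/andP[n0 ns] nmax QsE]] := Qstar_attained s s0.
  have := mmax n; rewrite n0 (le_trans ns st) => /(_ isT).
  have := nmax m; rewrite m0 (ltW ms) => /(_ isT).
  by rewrite /Q QsE /= => ? ?; apply/idP/idP; lra.
by apply/seteqP; split=> s /= [st]; rewrite SE.
Qed.

(** * Domination of every solution *)

Lemma solution_le (Q' : R -> R) : is_solution A C Q' ->
  forall t, 0 <= t -> Q' t <= Q t.
Proof.
move=> [mQ' _ Q'E] t t0; rewrite leNgt; apply/negP => Qlt.
have [m [mt mmax QE]] := Qstar_attained t t0.
(* The strict gap below [K] persists at [inf S] and leaves room for the continuity of [c] to act. *)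
have [K Km Kt] : exists2 K, c m - a m < K & K < Q' t + c t - a t.
  move: Qlt; rewrite /Q QE /= => Qlt.
  by exists ((c m - a m + (Q' t + c t - a t)) / 2); lra.
pose S := [set s | 0 <= s <= t /\ K < Q' s + c s - a s].
have S0 : lbound S 0 by move=> s [/andP[]].
have Sinf : has_inf S by split; [exists t; rewrite /S /= t0 lexx | exists 0].
have tau0 : 0 <= inf S by apply: lb_le_inf => //; case: Sinf.
have taut : inf S <= t.
  by apply: ge_inf; [case: Sinf | rewrite /S /= t0 lexx].
have tauK : c (inf S) - a (inf S) < K.
  by apply: le_lt_trans Km; apply: mmax; rewrite tau0.
have [d d0 cd] : exists2 d, 0 < d &
    forall s, inf S <= s -> s < inf S + d -> c s - K < a (inf S).
  have e0 : 0 < K - (c (inf S) - a (inf S)) by lra.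
  have /cvgrPdist_lt /(_ _ e0) /nbhs_ballP[d /= d0 cd] :=
    mass_continuous C_fin C_atomless (inf S).
  exists d => // s taus sd; have /cd : ball (inf S) d s.
    by rewrite /ball /= ltr_norml; lra.
  by rewrite /= ltr_norml -/c; lra.
(* The infimum need not belong to [S], so a member of [S] within [d] of it is used. *)
have [s Ss sd] := inf_adherent d0 Sinf.
have taus : inf S <= s by apply: ge_inf => //; case: Sinf.
have {cd sd}csK := cd s taus sd.
have [/andP[s0 st] KQ] := Ss.
have sub : `[0, s]%classic `&` [set r | c s < Q' r + c r] `<=`
    `[0, s]%classic `&` [set r | c s - K < a r].
  move=> r [rs /= csr]; split=> //=.
  have [taur|rtau] := leP (inf S) r.
    by apply: lt_le_trans csK _; exact: mass_nondecreasing.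
  have : ~ S r by move=> /(ge_inf (proj2 Sinf)); rewrite leNgt rtau.
  have rt : 0 <= r <= t.
    by move: rs; rewrite /= in_itv /= => /andP[-> rs] /=; exact: le_trans st.
  rewrite /S /= rt => Sr; rewrite ltNge; apply/negP => arK.
  by apply: Sr; split => //; lra.
have Ms : c s - a s <= c m - a m by apply: mmax; rewrite s0.
have : Q' s <= a s - c s + K; last lra.
rewrite -lee_fin Q'E // indic_integralE //.
(* The superlevel formula needs a nonnegative level; for a negative one, the mass [a s] of all of
   [[0, s]] is already below the bound. *)
have [csK0|csK0] := leP 0 (c s - K).
  rewrite (_ : a s - c s + K = a s - (c s - K)); last lra.
  rewrite -mass_superlevel //; last by rewrite -/a; lra.
  apply: le_measure => //; rewrite inE.
    apply: measurable_superlevel; apply: measurable_funD => //.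
  exact: measurable_mass.
  by apply: measurable_superlevel; exact: measurable_mass.
apply: (@le_trans _ _ (a s)%:E); last by rewrite lee_fin; lra.
rewrite -massE //; apply: le_measure; rewrite ?inE //.
by apply: measurable_superlevel; apply: measurable_funD => //; apply: measurable_mass.
Qed.

End Queue.

Theorem theorem1 (R : realType)
    (A C : {measure set (measurableTypeR R) -> \bar R})
    (A_nonneg : on_nonneg A) (C_nonneg : on_nonneg C)
    (A_fin : locally_finite A) (C_fin : locally_finite C)
    (A_atomless : atomless A) (C_atomless : atomless C) :
  exists Q : R -> R,
    [/\ is_maximal_solution A C Q,
        (forall Q' : R -> R, is_maximal_solution A C Q' ->
           forall t : R, 0 <= t -> Q' t = Q t) &
        (forall t : R, 0 <= t -> (Q t)%:E = Qstar A C t)].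
Proof.
have Qsol := Qstar_solution A_fin C_fin A_atomless C_atomless.
have Qmax := solution_le A_fin C_fin A_atomless C_atomless.
exists (fun t => fine (Qstar A C t)); split=> [|Q' [Q'sol Q'max] t t0|t t0].
- by split.
- by apply/eqP; rewrite eq_le Qmax //; exact: Q'max Qsol t t0.
- exact: fine_QstarE.
Qed.
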